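(* If $(OPF)$ is feasible, then there is no duality gap between $(SDP)$ and $(DSDP)$, i.e. $\mathtt{v}(SDP)=\mathtt{v}(DSDP)$. In other words, strong duality holds for the rank relaxation of a feasible OPF problem.
   Context: Notation: $\mathbb{S}_m(\mathbb{R})$ is the set of real symmetric $m\times m$ matrices; $\langle A,B\rangle$ is the canonical (trace/Frobenius) scalar product of matrices; $M\succeq 0$ means $M$ is symmetric positive semidefinite; $\mathbf{i}$ is the imaginary unit; $V^*$ is the conjugate transpose of $V$; $\mathtt{v}(P)$ is the optimal value of an optimization problem $(P)$ (infimum for a minimization problem, supremum for a maximization problem). The OPF problem: Let $N=\{1,\dots,n\}$ be the set of nodes of an electric network, partitioned into production nodes $N^G$ and consumption nodes $N^D$. The data are: costs $c_i\in\mathbb{R}$ and real bounds $P_i^{min},P_i^{max},Q_i^{min},Q_i^{max}$ for $i\in N^G$; demands $P_i^D,Q_i^D\in\mathbb{R}$ for $i\in N^D$; for each $i\in N$ a complex $n\times n$ matrix $Y_i$ (admittance matrix at node $i$) and voltage magnitude bounds $0\le V_i^{min}\le V_i^{max}$. The problem is to minimize $\sum_{i\in N^G}c_iP^G_i$ over $V\in\mathbb{C}^n$, $P^G,Q^G\in\mathbb{R}^{N^G}$ subject to $P^G_i+\mathbf{i}Q^G_i=V^*Y_iV$ for $i\in N^G$; $-P^D_i-\mathbf{i}Q^D_i=V^*Y_iV$ for $i\in N^D$; $P_i^{min}\le P_i^G\le P_i^{max}$ and $Q_i^{min}\le Q_i^G\le Q_i^{max}$ for $i\in N^G$; $(V_i^{min})^2\le|V_i|^2\le(V_i^{max})^2$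 for $i\in N$. Eliminating $P^G,Q^G$ and writing $x\in\mathbb{R}^{2n}$ with $x_i$ and $x_{i+n}$ the real and imaginary parts of $V_i$, this is the quadratic program $$(OPF)\qquad \min_{x\in\mathbb{R}^{2n}} x^tCx\quad\text{s.t.}\quad x^tA_kx\le b_k,\ k\in K,$$ where $C,A_k\in\mathbb{S}_{2n}(\mathbb{R})$, $b_k\in\mathbb{R}$, and $K$ is a finite index set with $|K|=6n$. Here $x^tCx=\sum_{i\in N^G}c_i\,\mathrm{Re}(V^*Y_iV)$, and the constraints indexed by $K$ are, for each node $i$: the two voltage magnitude constraints $x_i^2+x_{i+n}^2\le (V_i^{max})^2$ and $-x_i^2-x_{i+n}^2\le-(V_i^{min})^2$; and four inequalities bounding $\mathrm{Re}(V^*Y_iV)$ and $\mathrm{Im}(V^*Y_iV)$ above and below, by $P_i^{max},P_i^{min}$ and $Q_i^{max},Q_i^{min}$ if $i\in N^G$, and by $-P_i^D$ (both sides) and $-Q_i^D$ (both sides) if $i\in N^D$ (an equality being written as two inequalities). The rank relaxation of $(OPF)$ is $$(SDP)\qquad \min_{X\in\mathbb{S}_{2n}(\mathbb{R})}\langle C,X\rangle\quad\text{s.t.}\quad\langle A_k,X\rangle\le b_k,\ k\in K,\quad X\succeq0,$$ and its dual is $$(DSDP)\qquad \max_{\alpha\in\mathbb{R}^{|K|}}\ \sum_{k\in K}-b_k\alpha_k\quad\text{s.t.}\quad C+\sum_{k\in K}\alpha_kA_k\succeq0,\quad \alpha_k\ge0,\ k\in K.$$ *)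

(* Defs.v *)
(* MathComp / MathComp-Analysis; complex numbers are R[i] over R : realType. *)
From HB Require Import structures.
From mathcomp Require Import all_boot all_order all_algebra.
From mathcomp Require Import all_classical all_reals.
From mathcomp Require Import ereal complex.
From mathcomp Require Import ring lra.

Set Implicit Arguments.
Unset Strict Implicit.
Unset Printing Implicit Defensive.

Import Order.TTheory GRing.Theory Num.Theory.
Local Open Scope classical_set_scope.
Local Open Scope complex_scope.
Local Open Scope ring_scope.

Definition frob (R : realType) m (A B : 'M[R]_m) : R := \tr (A^T *m B).

Definition qform (R : realType) m (A : 'M[R]_m) (x : 'cV[R]_m) : R :=
  (x^T *m A *m x) 0 0.

Definition psdmx (R : realType) m (M : 'M[R]_m) : Prop :=
  M^T = M /\ forall x : 'cV[R]_m, 0 <= qform M x.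

(* The quadratic program  min x^t C x  s.t.  x^t A_k x <= b_k (k in K),  its  *)
(* rank relaxation and the dual of the latter.  Optimal values lie in \bar R, *)
(* so an infeasible minimization (maximization) has value +oo (-oo).          *)
Section QuadraticProgram.
Variables (R : realType) (m : nat) (K : finType).
Variables (C : 'M[R]_m) (A : K -> 'M[R]_m) (b : K -> R).

Definition qp_point (x : 'cV[R]_m) : Prop :=
  forall k, qform (A k) x <= b k.

Definition qp_feasible : Prop := exists x, qp_point x.

Definition sdp_point (X : 'M[R]_m) : Prop :=
  (forall k, frob (A k) X <= b k) /\ psdmx X.

Definition sdp_value : \bar R :=
  ereal_inf [set (frob C X)%:E | X in [set X | sdp_point X]].

Definition dsdp_point (alpha : K -> R) : Prop :=
  psdmx (C + \sum_k alpha k *: A k) /\ forall k, 0 <= alpha k.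

Definition dsdp_value : \bar R :=
  ereal_sup [set (\sum_k - b k * alpha k)%:E
            | alpha in [set alpha | dsdp_point alpha]].

End QuadraticProgram.

(* N^G is [gen] and N^D its complement.  Production (resp. consumption) data  *)
(* are total functions whose values outside N^G (resp. N^D) are never used.   *)
Record network (R : realType) (n : nat) := Network {
  gen : {set 'I_n};
  cost : 'I_n -> R;
  Pmin : 'I_n -> R;
  Pmax : 'I_n -> R;
  Qmin : 'I_n -> R;
  Qmax : 'I_n -> R;
  Pdem : 'I_n -> R;
  Qdem : 'I_n -> R;
  Ymx : 'I_n -> 'M[R[i]]_n;
  Vmin : 'I_n -> R;
  Vmax : 'I_n -> R;
  Vmin_ge0 : forall i, 0 <= Vmin i;
  Vmin_le_Vmax : forall i, Vmin i <= Vmax i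
}.

Definition cform (R : realType) n (Y : 'M[R[i]]_n) (V : 'cV[R[i]]_n) : R[i] :=
  ((map_mx (@conjc R) V)^T *m Y *m V) 0 0.

(* The OPF problem in its complex form; only used to validate [opf_mx] and    *)
(* [opf_rhs] below (see [opf_feasibleP]).                                     *)
Definition network_point (R : realType) n (N : network R n)
    (V : 'cV[R[i]]_n) (PG QG : 'I_n -> R) : Prop :=
  [/\ forall i, i \in gen N -> PG i +i* QG i = cform (Ymx N i) V,
      forall i, i \notin gen N ->
        (- Pdem N i) -i* Qdem N i = cform (Ymx N i) V,
      forall i, i \in gen N -> Pmin N i <= PG i <= Pmax N i,
      forall i, i \in gen N -> Qmin N i <= QG i <= Qmax N i
    & forall i, ((Vmin N i) ^+ 2)%:C <= `|V i 0| ^+ 2 <= ((Vmax N i) ^+ 2)%:C].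

Definition sympart (R : realType) m (M : 'M[R]_m) : 'M[R]_m :=
  2^-1 *: (M + M^T).

(* With V = u + i w, x = (u, w) and Y = G + i B,                              *)
(*   Re (V^* Y V) = u^t G u - u^t B w + w^t B u + w^t G w,                    *)
(*   Im (V^* Y V) = u^t B u + u^t G w - w^t G u + w^t B w.                    *)
Definition Reform_mx (R : realType) n (Y : 'M[R[i]]_n) : 'M[R]_(n + n) :=
  let G := map_mx (@complex.Re R) Y in let B := map_mx (@complex.Im R) Y in
  sympart (block_mx G (- B) B G).

Definition Imform_mx (R : realType) n (Y : 'M[R[i]]_n) : 'M[R]_(n + n) :=
  let G := map_mx (@complex.Re R) Y in let B := map_mx (@complex.Im R) Y in
  sympart (block_mx B G (- G) B).

Definition volt_mx (R : realType) n (i : 'I_n) : 'M[R]_(n + n) :=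
  delta_mx (lshift n i) (lshift n i) + delta_mx (rshift n i) (rshift n i).

Inductive ckind := VmaxC | VminC | PmaxC | PminC | QmaxC | QminC.

Definition ord_of_ckind (c : ckind) : 'I_6 :=
  inord (match c with
         | VmaxC => 0 | VminC => 1 | PmaxC => 2
         | PminC => 3 | QmaxC => 4 | QminC => 5 end).

Definition ckind_of_ord (j : 'I_6) : ckind :=
  nth VmaxC [:: VmaxC; VminC; PmaxC; PminC; QmaxC; QminC] j.

Lemma ord_of_ckindK : cancel ord_of_ckind ckind_of_ord.
Proof. by case; rewrite /ckind_of_ord /ord_of_ckind inordK. Qed.

HB.instance Definition _ := Finite.copy ckind (can_type ord_of_ckindK).

Definition opf_idx (n : nat) : finType := ('I_n * ckind)%type.

Lemma card_opf_idx n : #|opf_idx n| = (6 * n)%N.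
Proof.
rewrite card_prod card_ord mulnC; congr (_ * _)%N.
have ckindK : cancel ckind_of_ord ord_of_ckind.
  case=> [[|[|[|[|[|[|k]]]]]] Hk] //;
  by apply: val_inj; rewrite /ord_of_ckind /= inordK.
by rewrite (bij_eq_card (Bijective ord_of_ckindK ckindK)) card_ord.
Qed.

Section OPF.
Variables (R : realType) (n : nat) (N : network R n).

Definition opf_cost_mx : 'M[R]_(n + n) :=
  \sum_(i in gen N) cost N i *: Reform_mx (Ymx N i).

Definition opf_mx (k : opf_idx n) : 'M[R]_(n + n) :=
  let i := k.1 in
  match k.2 with
  | VmaxC => volt_mx R i
  | VminC => - volt_mx R i
  | PmaxC => Reform_mx (Ymx N i)
  | PminC => - Reform_mx (Ymx N i)
  | QmaxC => Imform_mx (Ymx N i)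
  | QminC => - Imform_mx (Ymx N i)
  end.

Definition opf_rhs (k : opf_idx n) : R :=
  let i := k.1 in
  match k.2 with
  | VmaxC => Vmax N i ^+ 2
  | VminC => - (Vmin N i ^+ 2)
  | PmaxC => if i \in gen N then Pmax N i else - Pdem N i
  | PminC => if i \in gen N then - Pmin N i else Pdem N i
  | QmaxC => if i \in gen N then Qmax N i else - Qdem N i
  | QminC => if i \in gen N then - Qmin N i else Qdem N i
  end.

Definition opf_feasible : Prop := qp_feasible opf_mx opf_rhs.

Definition opf_sdp_value : \bar R := sdp_value opf_cost_mx opf_mx opf_rhs.

Definition opf_dsdp_value : \bar R := dsdp_value opf_cost_mx opf_mx opf_rhs.

End OPF.

Section Sanity.
Variables (R : realType) (n : nat).
Implicit Types (Y : 'M[R[i]]_n) (V : 'cV[R[i]]_n).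

Definition vec_of V : 'cV[R]_(n + n) :=
  col_mx (map_mx (@complex.Re R) V) (map_mx (@complex.Im R) V).

Lemma tr_sympart m (M : 'M[R]_m) : (sympart M)^T = sympart M.
Proof. by rewrite /sympart !linearE /= !linearE /= trmxK addrC. Qed.

Lemma qform_tr m (M : 'M[R]_m) x : qform M^T x = qform M x.
Proof.
have -> : qform M^T x = (x^T *m M *m x)^T 0 0.
  by rewrite !trmx_mul trmxK mulmxA.
by rewrite mxE.
Qed.

Lemma qformD m (M1 M2 : 'M[R]_m) x :
  qform (M1 + M2) x = qform M1 x + qform M2 x.
Proof. by rewrite /qform mulmxDr mulmxDl mxE. Qed.

Lemma qformN m (M : 'M[R]_m) x : qform (- M) x = - qform M x.
Proof. by rewrite /qform mulmxN mulNmx mxE. Qed.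

Lemma qformZ m a (M : 'M[R]_m) x : qform (a *: M) x = a * qform M x.
Proof. by rewrite /qform -scalemxAr -scalemxAl mxE. Qed.

Lemma qform_sympart m (M : 'M[R]_m) x : qform (sympart M) x = qform M x.
Proof.
by rewrite qformZ qformD qform_tr -mulr2n -[qform M x *+ 2]mulr_natl mulKf.
Qed.


Lemma cformE Y V :
  cform Y V = qform (Reform_mx Y) (vec_of V) +i* qform (Imform_mx Y) (vec_of V).
Proof.
rewrite !qform_sympart /qform /vec_of.
set u := map_mx _ V; set w := map_mx _ V.
set G := map_mx _ Y; set B := map_mx _ Y.
have qblock (M11 M12 M21 M22 : 'M[R]_n) :
    ((col_mx u w)^T *m block_mx M11 M12 M21 M22 *m col_mx u w) 0 0 =
    \sum_j \sum_k (u k 0 * M11 k j * u j 0 + w k 0 * M21 k j * u j 0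
                 + (u k 0 * M12 k j * w j 0 + w k 0 * M22 k j * w j 0)).
  rewrite tr_col_mx mul_row_block mul_row_col mxE ![in LHS]mxE -big_split /=.
  apply: eq_bigr => j _; rewrite !mxE !mulrDl !mulr_suml -!big_split /=.
  by apply: eq_bigr => k _; rewrite !mxE.
rewrite !qblock /cform mxE.
have cC (F1 F2 : 'I_n -> R) :
    \sum_k (F1 k +i* F2 k) = (\sum_k F1 k) +i* (\sum_k F2 k).
  elim/big_ind3: _ => //= x1 x2 y1 y2 z1 z2 -> ->.
  by [].
rewrite -cC; apply: eq_bigr => j _; rewrite -cC mxE mulr_suml.
apply: eq_bigr => k _; rewrite !mxE.
case: (V k 0) => a c; case: (V j 0) => a' c'; case: (Y k j) => g h /=.
by congr (_ +i* _); rewrite /=; ring.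
Qed.

Lemma opf_costE (N : network R n) V :
  qform (opf_cost_mx N) (vec_of V) =
  \sum_(i in gen N) cost N i * complex.Re (cform (Ymx N i) V).
Proof.
rewrite /opf_cost_mx.
elim/big_rec2: _ => [|i y M _ <-]; first by rewrite /qform mulmx0 mul0mx mxE.
by rewrite qformD qformZ cformE.
Qed.

Lemma tr_opf_cost_mx (N : network R n) : (opf_cost_mx N)^T = opf_cost_mx N.
Proof.
rewrite /opf_cost_mx linear_sum /=; apply: eq_bigr => i _.
by rewrite linearZ /= tr_sympart.
Qed.

Lemma tr_opf_mx (N : network R n) k : (opf_mx N k)^T = opf_mx N k.
Proof.
have tv i : (volt_mx R i)^T = volt_mx R i by rewrite linearD /= !trmx_delta.
by case: k => i [] //=; rewrite /opf_mx /= ?linearN /= ?tv ?tr_sympart.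
Qed.

Lemma qform_volt i V :
  (qform (volt_mx R i) (vec_of V))%:C = `|V i 0| ^+ 2.
Proof.
rewrite qformD -add_Re2_Im2; congr (_ %:C).
have qd (x : 'cV[R]_(n + n)) j : qform (delta_mx j j) x = x j 0 ^+ 2.
  rewrite /qform -(mul_delta_mx (0 : 'I_1)) mulmxA -mulmxA -colE -rowE.
  by rewrite mxE big_ord1 !mxE.
by rewrite !qd /vec_of col_mxEu col_mxEd !mxE.
Qed.

Lemma opf_feasibleP (N : network R n) :
  opf_feasible N <-> exists V PG QG, network_point N V PG QG.
Proof.
split=> [[x Hx]|[V [PG [QG [HG HD HP HQ HV]]]]].
- pose V : 'cV[R[i]]_n := \col_i (x (lshift n i) 0 +i* x (rshift n i) 0).
  have xV : x = vec_of V.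
    rewrite -[LHS]vsubmxK; congr col_mx;
    by apply/matrixP => j o; rewrite (ord1 o) !mxE.
  exists V, (fun i => complex.Re (cform (Ymx N i) V)),
            (fun i => complex.Im (cform (Ymx N i) V)).
  have H i c := Hx (i, c).
  split=> i.
  + by case: (cform _ _).
  + move=> /negPf Ni; rewrite cformE -xV.
    have := H i PmaxC; have := H i PminC; have := H i QmaxC; have := H i QminC.
    rewrite /opf_mx /opf_rhs /= Ni !qformN => q1 q2 p1 p2.
    by congr (_ +i* _); apply/eqP; rewrite eq_le; apply/andP; split; lra.
  + move=> Ni; rewrite cformE -xV /=.
    have := H i PmaxC; have := H i PminC.
    by rewrite /opf_mx /opf_rhs /= Ni !qformN lerN2 => -> ->.
  + move=> Ni; rewrite cformE -xV /=.
    have := H i QmaxC; have := H i QminC.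
    by rewrite /opf_mx /opf_rhs /= Ni !qformN lerN2 => -> ->.
  + rewrite -qform_volt -xV !lecR.
    have := H i VmaxC; have := H i VminC.
    by rewrite /opf_mx /opf_rhs /= !qformN lerN2 => -> ->.
- exists (vec_of V) => -[i c].
  have := HV i; rewrite -qform_volt !lecR => /andP[v1 v2].
  have [Ni|Ni] := boolP (i \in gen N).
  + have := HG i Ni; rewrite cformE => -[eP eQ].
    have := HP i Ni; rewrite eP => /andP[p1 p2].
    have := HQ i Ni; rewrite eQ => /andP[q1 q2].
    by case: c; rewrite /opf_mx /opf_rhs /= ?Ni ?qformN ?lerN2.
  + have := HD i Ni; rewrite cformE => -[eP eQ].
    by case: c; rewrite /opf_mx /opf_rhs /= ?(negPf Ni) ?qformN
       ?lerN2 -?eP -?eQ ?opprK.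
Qed.

End Sanity.

(* Main.v *)
Require Import Defs.
From mathcomp Require Import all_boot all_order all_algebra.
From mathcomp Require Import all_classical all_reals.
From mathcomp Require Import ereal topology normedtype derive realfun.
From mathcomp Require Import ring lra.

(** The upper voltage bounds make strong duality work without any Slater
    condition on the primal side.  The matrices of these constraints add up to
    the identity, so a nonnegative combination [beta] of the constraint
    matrices is [1%:M], and every feasible [X] has trace at most
    T = \sum_k beta_k b_k.  Duality then holds for every semidefinite program
    with this property that has a feasible point ([sdp_strong_duality]).

    Weak duality is the self-duality of the positive semidefinite cone, in the
    form [frob_psdmx_ge0].

    Conversely, let c be a real below the primal value.  On the set of positive
    semidefinite X with \tr X <= T + 1, which is compact and convex, the
    inequalities <C, X> <= c and <A_k, X> <= b_k have no common solution.  By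
    [theorem_of_alternative] a nonnegative combination
    lam_0 (<C, X> - c) + \sum_k lam_k (<A_k, X> - b_k) is positive on that set.
    A feasible point of the program forces lam_0 > 0, so one may take lam_0 = 1:
    with M = C + \sum_k lam_k A_k and r = c + \sum_k lam_k b_k, one gets
    r <= <M, X> on the compact set.  Testing X = 0 gives r <= 0, and testing
    multiples of x x^t of trace T + 1 gives M + t I >= 0 for t = - r / (T + 1)
    ([psdmx_add_scalar]).  The shift by t I is paid for by adding t beta to the
    multipliers, which costs t T <= t (T + 1) = - r; the dual objective
    - \sum_k lam_k b_k - t T is therefore still at least c
    ([lagrange_multipliers]).  Letting c tend to the primal value closes the
    gap.

    An OPF point x gives the feasible matrix x x^t of the relaxation. *)

Set Implicit Arguments.
Unset Strict Implicit.
Unset Printing Implicit Defensive.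

Import Order.TTheory GRing.Theory Num.Theory.
Import numFieldNormedType.Exports.
Local Open Scope classical_set_scope.
Local Open Scope ring_scope.

(** * Frobenius product and quadratic forms *)

Section Frobenius.
Context {R : realType} {m : nat}.
Implicit Types (M X : 'M[R]_m) (x y : 'cV[R]_m).

Lemma frobE M X : frob M X = \sum_i \sum_j M i j * X i j.
Proof.
rewrite /frob /mxtrace exchange_big; apply: eq_bigr => i _.
by rewrite mxE; apply: eq_bigr => j _; rewrite mxE.
Qed.

Lemma frobDl M1 M2 X : frob (M1 + M2) X = frob M1 X + frob M2 X.
Proof. by rewrite /frob linearD mulmxDl mxtraceD. Qed.

Lemma frobZl a M X : frob (a *: M) X = a * frob M X.
Proof. by rewrite /frob linearZ -scalemxAl mxtraceZ. Qed.

Lemma frob_suml (I : finType) (F : I -> 'M[R]_m) X :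
  frob (\sum_i F i) X = \sum_i frob (F i) X.
Proof. by rewrite /frob linear_sum mulmx_suml linear_sum. Qed.

Lemma frobDr M X1 X2 : frob M (X1 + X2) = frob M X1 + frob M X2.
Proof. by rewrite /frob mulmxDr mxtraceD. Qed.

Lemma frobZr a M X : frob M (a *: X) = a * frob M X.
Proof. by rewrite /frob -scalemxAr mxtraceZ. Qed.

Lemma frob0r M : frob M 0 = 0.
Proof. by rewrite /frob mulmx0 mxtrace0. Qed.

Lemma frob1l X : frob 1%:M X = \tr X.
Proof. by rewrite /frob trmx1 mul1mx. Qed.

Lemma frob_rank1 M x : frob M (x *m x^T) = qform M x.
Proof.
by rewrite /frob mulmxA mxtrace_mulC mulmxA /mxtrace big_ord1 -qform_tr.
Qed.

Lemma frob_rank1l M x : frob (x *m x^T) M = qform M x.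
Proof.
rewrite -frob_rank1 !frobE; apply: eq_bigr => i _; apply: eq_bigr => j _.
exact: mulrC.
Qed.

Lemma qform_rank1 x y : qform (x *m x^T) y = ((x^T *m y) 0 0) ^+ 2.
Proof.
rewrite /qform mulmxA -mulmxA mxE big_ord1.
have -> : (y^T *m x) 0 0 = (x^T *m y) 0 0.
  by rewrite -[in RHS](trmxK y) -[in RHS]trmx_mul [RHS]mxE.
by rewrite expr2.
Qed.

Lemma qform1 x : qform 1%:M x = \sum_i x i 0 ^+ 2.
Proof.
by rewrite /qform mulmx1 mxE; apply: eq_bigr => i _; rewrite mxE expr2.
Qed.

Lemma qform1_eq0 x : qform 1%:M x = 0 -> x = 0.
Proof.
rewrite qform1 => /psumr_eq0P x0; apply/colP => i; rewrite mxE.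
by apply/eqP; rewrite -(sqrf_eq0 (x i 0)) x0// => j _; exact: sqr_ge0.
Qed.

Lemma qform_shift M y i t : M^T = M ->
  qform M (y + t *: delta_mx i 0) =
  qform M y + 2 * t * ((col i M)^T *m y) 0 0 + t ^+ 2 * M i i.
Proof.
move=> Msym; rewrite /qform.
have e1 : (delta_mx i 0)^T *m M *m y = (col i M)^T *m y.
  by rewrite colE trmx_mul Msym.
have e2 : y^T *m M *m delta_mx i 0 = ((col i M)^T *m y)^T.
  by rewrite trmx_mul trmxK colE mulmxA.
have e3 : (delta_mx i 0)^T *m M *m (delta_mx i 0 : 'cV_m) = (M i i)%:M.
  apply/matrixP => a b; rewrite (ord1 a) (ord1 b) trmx_delta -rowE -colE.
  by rewrite !mxE.
have -> : (y + t *: delta_mx i 0)^T = y^T + t *: (delta_mx i 0)^T.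
  by rewrite linearD linearZ.
rewrite !mulmxDl !mulmxDr -!scalemxAl -!scalemxAr e1 e2 e3.
rewrite !mxE eqxx mulr1n.
set u := \sum_j _; set v := \sum_j _; ring.
Qed.

Lemma qform_delta M i : M^T = M -> qform M (delta_mx i 0) = M i i.
Proof.
move=> Msym; have := @qform_shift M 0 i 1 Msym.
by rewrite add0r scale1r {2}/qform !mulmx0 !mxE mulr0 !add0r expr1n mul1r.
Qed.
End Frobenius.

(** * The positive semidefinite cone *)

Section PositiveSemidefinite.
Context {R : realType} {m : nat}.
Implicit Types (M X : 'M[R]_m) (x y : 'cV[R]_m).

Lemma psdmx_diag_ge0 X i : psdmx X -> 0 <= X i i.
Proof. by case=> Xsym X0; rewrite -qform_delta. Qed.

Lemma psdmx_trace_ge0 X : psdmx X -> 0 <= \tr X.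
Proof. by move=> X0; apply: sumr_ge0 => i _; exact: psdmx_diag_ge0. Qed.

Lemma psdmx0 : psdmx (0 : 'M[R]_m).
Proof. by split=> [|x]; rewrite ?trmx0// /qform mulmx0 mul0mx mxE. Qed.

Lemma psdmxD M X : psdmx M -> psdmx X -> psdmx (M + X).
Proof.
move=> [Ms M0] [Xs X0]; split=> [|x]; first by rewrite linearD/= Ms Xs.
by rewrite qformD addr_ge0.
Qed.

Lemma psdmxZ a X : 0 <= a -> psdmx X -> psdmx (a *: X).
Proof.
move=> a0 [Xs X0]; split=> [|x]; first by rewrite linearZ/= Xs.
by rewrite qformZ mulr_ge0.
Qed.

Lemma psdmx_rank1 x : psdmx (x *m x^T).
Proof.
split=> [|y]; first by rewrite trmx_mul trmxK.
by rewrite qform_rank1 sqr_ge0.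
Qed.

(** Positivity of the quadratic form at [e_j + e_i] and [e_j - e_i]. *)
Lemma psdmx_entry_le X i j : psdmx X -> 2 * `|X i j| <= X i i + X j j.
Proof.
move=> [Xs X0]; have XC : X j i = X i j by rewrite -[in RHS]Xs mxE.
have H t : t ^+ 2 = 1 -> 0 <= X j j + 2 * t * X i j + X i i.
  move=> t1; have := X0 (delta_mx j 0 + t *: delta_mx i 0).
  rewrite qform_shift// qform_delta// t1 mul1r.
  by rewrite -colE !mxE XC.
have := H 1 (expr1n _ _); have := H (-1); rewrite sqrrN expr1n => /(_ erefl).
by case: (ger0P (X i j)) => _; lra.
Qed.

Lemma psdmx_entry_trace X i j : psdmx X -> `|X i j| <= \tr X.
Proof.
move=> X0.
have le_tr k : X k k <= \tr X.
  rewrite /mxtrace (bigD1 k)//= lerDl sumr_ge0// => l _.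
  exact: psdmx_diag_ge0.
have := psdmx_entry_le i j X0; have := le_tr i; have := le_tr j; lra.
Qed.

(** One step of a Cholesky decomposition: the form of the difference at [y] is
    the minimum over [t] of the form of [X] at [y + t e_i]. *)
Lemma psdmx_schur X i : psdmx X -> 0 < X i i ->
  psdmx (X - (X i i)^-1 *: (col i X *m (col i X)^T)).
Proof.
move=> [Xs X0] Xi; split=> [|y].
  by rewrite linearB linearZ/= trmx_mul trmxK Xs.
have := X0 (y + - (((col i X)^T *m y) 0 0 / X i i) *: delta_mx i 0).
rewrite qform_shift// qformD qformN qformZ qform_rank1.
set u := (_ *m y) 0 0; move: (qform X y) => q.
suff -> : q + 2 * - (u / X i i) * u + (- (u / X i i)) ^+ 2 * X i i =
          q - (X i i)^-1 * u ^+ 2 by [].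
by field; rewrite gt_eqF.
Qed.

(** Subtracting from [X] the rank-one matrix of [psdmx_schur] lowers the product
    with [M] by a nonnegative multiple of a value of the form of [M], and turns
    a nonzero diagonal entry of [X] into zero without creating new ones.  After
    finitely many steps the diagonal is zero, which forces [X] to be zero.  This
    avoids any appeal to a spectral decomposition. *)
Lemma frob_psdmx_ge0 M X : psdmx M -> psdmx X -> 0 <= frob M X.
Proof.
move=> M0; have [k] := ubnP #|[pred i | X i i != 0]|.
elim: k X => // k IH X; rewrite ltnS => leXk X0.
have [i /= Xi0|Xd0] := pickP [pred i | X i i != 0]; last first.
  have Xii i : X i i = 0 by apply/eqP/negbFE/Xd0.
  suff -> : X = 0 by rewrite frob0r.
  apply/matrixP => i j; rewrite mxE; apply/eqP; rewrite -normr_le0.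
  by have := psdmx_entry_le i j X0; rewrite !Xii; lra.
have Xi : 0 < X i i by rewrite lt_def Xi0 psdmx_diag_ge0.
have X'0 := psdmx_schur X0 Xi.
set X' := X - _ in X'0.
have -> : frob M X = frob M X' + (X i i)^-1 * qform M (col i X).
  by rewrite -frob_rank1 -frobZr -frobDr subrK.
rewrite addr_ge0 ?mulr_ge0 ?invr_ge0 ?(ltW Xi)//; last by case: M0.
(* It remains to see that X' has fewer nonzero diagonal entries than X. *)
apply: IH => //; apply: leq_trans leXk; apply: proper_card.
have X'E j : X' j j = X j j - (X i i)^-1 * X j i ^+ 2.
  by rewrite !mxE big_ord1 !mxE expr2.
apply/properP; split.
  apply/fintype.subsetP => j; rewrite !inE; apply: contra_neq => Xj.
  apply/eqP; rewrite eq_le psdmx_diag_ge0// andbT X'E Xj sub0r oppr_le0.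
  by rewrite mulr_ge0 ?invr_ge0 ?sqr_ge0 ?ltW.
exists i; rewrite inE// X'E expr2 mulKf// subrr eqxx//.
Qed.
End PositiveSemidefinite.

(** * Compactness of trace-bounded positive semidefinite matrices *)

Lemma sum_continuous (R : realType) (T : topologicalType) (I : finType)
    (f : I -> T -> R) :
  (forall i, continuous (f i)) -> continuous (fun x => \sum_i f i x).
Proof. by move=> fc; apply: continuous_big => //; exact: add_continuous. Qed.

Section Compactness.
Context {R : realType} {m : nat}.
Implicit Types (M X : 'M[R]_m).

Lemma frob_continuous M : continuous (frob M : 'M[R]_m -> R).
Proof.
have -> : frob M = fun X : 'M[R]_m => \sum_i \sum_j M i j * X i j.
  by apply/funext => X; rewrite frobE.
apply: (@sum_continuous R 'M[R]_m) => i.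
apply: (@sum_continuous R 'M[R]_m) => j X.
apply: (@continuousM R 'M[R]_m (fun=> M i j) (fun Y => Y i j)).
  exact: cst_continuous.
exact: coord_continuous.
Qed.

(** Transports compactness of boxes of row vectors to square matrices. *)
Lemma vec_mx_continuous : continuous (vec_mx : 'rV[R]_(m * m) -> 'M[R]_m).
Proof.
move=> v A [P Pv PA].
suff : \forall w \near v, forall ij : 'I_m * 'I_m,
    P ij.1 ij.2 (vec_mx w ij.1 ij.2).
  by apply: filterS => w Pw; apply: PA => i j; exact: (Pw (i, j)).
apply: (@filter_forall _ _ (fun ij w => P ij.1 ij.2 (vec_mx w ij.1 ij.2))
  (nbhs v) (nbhs_filter v)) => -[i j].
have := Pv i j; rewrite mxE => Pvij.
have := @coord_continuous R 1 (m * m) 0 (mxvec_index i j) v _ Pvij.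
by apply: (@filterS _ _ (nbhs_filter v)) => w /=; rewrite mxE.
Qed.

Lemma compact_box (T : R) :
  compact [set X : 'M[R]_m | forall i j, `|X i j| <= T].
Proof.
have -> : [set X : 'M[R]_m | forall i j, `|X i j| <= T] =
  vec_mx @` [set v : 'rV[R]_(m * m) | forall k, `[- T, T]%classic (v ord0 k)].
  apply/seteqP; split => [X XT|_ /= [v vT <-] i j].
    exists (mxvec X); last exact: mxvecK.
    move=> k /=; case/mxvec_indexP: k => i j.
    by rewrite mxvecE in_itv/= -ler_norml.
  by rewrite mxE ler_norml; have := vT (mxvec_index i j); rewrite /= in_itv.
apply: continuous_compact; first exact/continuous_subspaceT/vec_mx_continuous.
have := @rV_compact R (m * m) (fun=> `[- T, T]%classic).
by apply=> _; exact: segment_compact.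
Qed.

Definition psd_trace_le (T : R) : set 'M[R]_m :=
  [set X | psdmx X /\ \tr X <= T].

Lemma closed_frob_le M (a : R) : closed [set X | frob M X <= a].
Proof.
by move/continuous_closedP: (@frob_continuous M) => /(_ _ (@closed_le R a)).
Qed.

Lemma closed_frob_ge M (a : R) : closed [set X | a <= frob M X].
Proof.
by move/continuous_closedP: (@frob_continuous M) => /(_ _ (@closed_ge R a)).
Qed.

(** The entries are bounded by the trace, and the set is an intersection of
    closed half-spaces: symmetry is a family of inequalities [X i j >= X j i],
    and positivity one inequality for each vector. *)
Lemma compact_psd_trace_le (T : R) : compact (psd_trace_le T).
Proof.
apply: (subclosed_compact _ (@compact_box T)); last first.
  move=> X [X0 XT] i j; exact: le_trans (psdmx_entry_trace i j X0) XT.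
have -> : psd_trace_le T =
  (\bigcap_(ij : 'I_m * 'I_m)
     [set X : 'M[R]_m |
       0 <= frob (delta_mx ij.1 ij.2 + (-1) *: delta_mx ij.2 ij.1) X])
  `&` (\bigcap_(x : 'cV[R]_m) [set X : 'M[R]_m | 0 <= frob (x *m x^T) X])
  `&` [set X : 'M[R]_m | frob 1%:M X <= T].
  have frobd i j X : frob (delta_mx i j) X = X i j.
    rewrite /frob trmx_delta -(mul_delta_mx (0 : 'I_1)) -mulmxA mxtrace_mulC.
    by rewrite -rowE -colE /mxtrace big_ord1 !mxE.
  apply/seteqP; split => [X [[Xs X0] XT]|X [[/= Xs X0] XT]]/=.
  - rewrite frob1l; split => //; split=> [[i j] _|x _] /=.
      have XC : X j i = X i j by rewrite -[in RHS]Xs mxE.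
      by rewrite frobDl frobZl !frobd XC mulN1r subrr.
    by rewrite frob_rank1l.
  - split; last by rewrite -frob1l.
    split=> [|x]; last by rewrite -frob_rank1l; exact: X0.
    apply/matrixP => i j; rewrite mxE; apply/eqP; rewrite eq_le.
    have := Xs (i, j) I; have := Xs (j, i) I.
    by rewrite /= !frobDl !frobZl !frobd => ? ?; apply/andP; split; lra.
apply: closedI; last exact: closed_frob_le.
by apply: closedI; apply: closed_bigI => ? _; exact: closed_frob_ge.
Qed.

End Compactness.

(** * Separation of a compact convex set from an orthant *)

Section Separation.
Context {R : realType} {m : nat}.
Implicit Types (M X Y : 'M[R]_m).

(** First-order condition at a minimum: a parabola without constant term that is
    nonnegative on [0, 1] has nonnegative slope at 0. *)
Lemma min_slope_ge0 (S Q : R) :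
  0 <= Q -> (forall s, 0 <= s <= 1 -> 0 <= 2 * s * S + s ^+ 2 * Q) -> 0 <= S.
Proof.
move=> Q0 H; rewrite leNgt; apply/negP => S0.
have QS : 0 < Q - S by lra.
(* This s lies in ]0, 1] and makes the value of the parabola s S (1 + s) < 0. *)
set s := - S / (Q - S).
have s0 : 0 < s by rewrite divr_gt0// oppr_gt0.
have s1 : s <= 1 by rewrite ler_pdivrMr// mul1r; lra.
have sQS : s * (Q - S) = - S by rewrite divfK// gt_eqF.
have /H : 0 <= s <= 1 by rewrite s1 ltW.
have -> : 2 * s * S + s ^+ 2 * Q = s * (S + s * S).
  have -> : 2 * s * S + s ^+ 2 * Q = s * (2 * S + s * (Q - S) + s * S) by ring.
  by rewrite sQS; congr (_ * _); ring.
rewrite pmulr_rge0//; have : s * S < 0 by rewrite pmulr_rlt0.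
by lra.
Qed.

(** Minimize over [D] the squared distance of the residual vector
    (<F_j, X> - h_j)_j to the nonpositive orthant, that is the sum of the squares
    of its positive parts.  At a minimizer [Z] these positive parts are the
    multipliers [lam]: by first-order optimality the residual in the direction
    [lam] is smallest at [Z], where it equals the squared norm of [lam], and
    [lam] is nonzero because no point of [D] satisfies all inequalities. *)
Lemma theorem_of_alternative (D : set 'M[R]_m) (J : finType)
    (F : J -> 'M[R]_m) (h : J -> R) :
  D !=set0 -> compact D ->
  (forall X Y s, D X -> D Y -> 0 <= s <= 1 -> D (X + s *: (Y - X))) ->
  (forall X, D X -> exists j, h j < frob (F j) X) ->
  exists2 lam : J -> R, forall j, 0 <= lam j &
    forall X, D X -> 0 < \sum_j lam j * (frob (F j) X - h j).
Proof.
move=> D0 Dcpt Dcvx Dsep.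
pose g j X := frob (F j) X - h j.
pose phi X := \sum_j Num.max 0 (g j X) ^+ 2.
have gE j X Y s : g j (X + s *: (Y - X)) = g j X + s * (g j Y - g j X).
  by rewrite /g frobDr frobZr frobDr -scaleN1r frobZr; ring.
have phi_cont : continuous phi.
  apply: (@sum_continuous R 'M[R]_m) => j X.
  apply: (@continuous_comp _ _ _ (fun X => Num.max 0 (g j X))
      (fun a : R => a ^+ 2));
    last exact: exprn_continuous.
  apply: (@continuous_max R 'M[R]_m (fun=> 0) (g j)).
    exact: cst_continuous.
  apply: (@continuousB R R 'M[R]_m (frob (F j)) (fun=> h j)).
    exact: frob_continuous.
  exact: cst_continuous.
have [Z] := compact_EVT_min D0 Dcpt (continuous_subspaceT phi_cont).
rewrite inE => DZ Zmin.
pose lam j := Num.max 0 (g j Z).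
have lam0 j : 0 <= lam j by rewrite le_max lexx.
exists lam => // X DX.
have -> : \sum_j lam j * (frob (F j) X - h j) =
    \sum_j lam j * (g j X - g j Z) + \sum_j lam j ^+ 2.
  rewrite -big_split; apply: eq_bigr => j _ /=.
  have -> : lam j ^+ 2 = lam j * g j Z.
    by rewrite /lam; case: (leP 0 (g j Z)) => _; rewrite ?expr2 ?mul0r.
  by rewrite -mulrDr subrK.
apply: ltr_wpDl.
  apply: (@min_slope_ge0 _ (\sum_j (g j X - g j Z) ^+ 2)).
    by apply: sumr_ge0 => j _; exact: sqr_ge0.
  move=> s s01.
  (* Moving by s towards X changes residual j by s d; its squared positive part
     is at most (lam j + s d) ^+ 2, since lam j dominates the residual at Z. *)
  have := Zmin (Z + s *: (X - Z)).
  rewrite inE => /(_ (Dcvx _ _ _ DZ DX s01)).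
  rewrite -subr_ge0 => /le_trans; apply.
  rewrite /phi -sumrB !mulr_sumr -big_split/=; apply: ler_sum => j _.
  rewrite gE -/(lam j); set d := g j X - g j Z.
  rewrite lerBlDr.
  have -> : 2 * s * (lam j * d) + s ^+ 2 * d ^+ 2 + lam j ^+ 2 =
            (lam j + s * d) ^+ 2 by ring.
  have glam : g j Z <= lam j by rewrite le_max lexx orbT.
  case: (leP 0 (g j Z + s * d)) => gs; last by rewrite expr0n sqr_ge0.
  by rewrite lerXn2r ?nnegrE ?lerD2r//; apply: le_trans gs _; rewrite lerD2r.
have [j hj] := Dsep Z DZ.
rewrite (bigD1 j)//= ltr_pwDl//.
  by rewrite exprn_gt0// lt_max subr_gt0 hj orbT.
by apply: sumr_ge0 => k _; exact: sqr_ge0.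
Qed.

End Separation.

(** * Strong duality under a trace bound *)

Lemma big_option (V : nmodType) (K : finType) (f : option K -> V) :
  \sum_j f j = f None + \sum_k f (Some k).
Proof.
rewrite (bigD1 None)//=; congr (_ + _).
rewrite (reindex_omap Some id)/=; last by case.
by apply: eq_bigl => k; rewrite eqxx.
Qed.

Section Duality.
Context {R : realType} {m : nat} {K : finType}.
Context (C : 'M[R]_m) (A : K -> 'M[R]_m) (b : K -> R).

(** The hypothesis bounds the form of [M] below on the sphere of squared radius
    [T], through the rank-one matrices of trace [T]; the bound extends to all
    vectors by homogeneity. *)
Lemma psdmx_add_scalar (M : 'M[R]_m) (T r : R) : M^T = M -> 0 < T ->
  (forall X, psd_trace_le T X -> r <= frob M X) ->
  psdmx (M + (- r / T) *: 1%:M).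
Proof.
move=> Ms T0 rM; split=> [|x]; first by rewrite linearD linearZ/= trmx1 Ms.
have [/qform1_eq0->|x0] := eqVneq (qform 1%:M x) 0.
  by rewrite /qform mulmx0 mxE.
have {x0} s0 : 0 < qform 1%:M x.
  by rewrite lt_def x0 qform1 sumr_ge0// => i _; exact: sqr_ge0.
rewrite qformD qformZ; set s := qform 1%:M x in s0 *.
have /rM : psd_trace_le T ((T / s) *: (x *m x^T)).
  split; first by apply: psdmxZ (psdmx_rank1 x); rewrite divr_ge0// ltW.
  by rewrite -frob1l frobZr frob_rank1 divfK// gt_eqF.
rewrite frobZr frob_rank1 => rT.
have -> : qform M x + - r / T * s = s / T * (T / s * qform M x - r).
  by field; rewrite !gt_eqF.
by rewrite mulr_ge0 ?subr_ge0// divr_ge0 ?ltW.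
Qed.

Lemma frob_lagrangian (alpha : K -> R) X :
  frob (C + \sum_k alpha k *: A k) X =
  frob C X + \sum_k alpha k * frob (A k) X.
Proof.
rewrite frobDl frob_suml; congr (_ + _).
by apply: eq_bigr => k _; rewrite frobZl.
Qed.

Lemma weak_duality X alpha : sdp_point A b X -> dsdp_point C A alpha ->
  \sum_k - b k * alpha k <= frob C X.
Proof.
move=> [AXb X0] [M0 alpha0].
have := frob_psdmx_ge0 M0 X0; rewrite frob_lagrangian => LX.
suff : \sum_k alpha k * frob (A k) X <= - \sum_k - b k * alpha k by lra.
rewrite -sumrN; apply: ler_sum => k _.
by rewrite mulNr opprK [leRHS]mulrC ler_wpM2l.
Qed.

Context (beta : K -> R).
Context (beta_ge0 : forall k, 0 <= beta k).
Context (sum_beta : \sum_k beta k *: A k = 1%:M).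
Context (Csym : C^T = C).
Context (Asym : forall k, (A k)^T = A k).

Lemma trace_bound X : sdp_point A b X -> \tr X <= \sum_k beta k * b k.
Proof.
move=> [AXb _]; rewrite -frob1l -sum_beta frob_suml; apply: ler_sum => k _.
by rewrite frobZl ler_wpM2l.
Qed.

(** The separating multipliers, scaled to weight one on the objective, make the
    Lagrangian matrix nearly positive semidefinite; a multiple of [beta] repairs
    it, and the gap left by testing the zero matrix covers its cost. *)
Lemma lagrange_multipliers c X0 : sdp_point A b X0 ->
  (forall X, sdp_point A b X -> c < frob C X) ->
  exists2 alpha, dsdp_point C A alpha & c <= \sum_k - b k * alpha k.
Proof.
move=> X0b cC.
set T := \sum_k beta k * b k.
have T0 : 0 <= T.
  by apply: le_trans (trace_bound X0b); case: X0b => _ /psdmx_trace_ge0.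
(* The bound T + 1 replaces T because T may vanish, and later a division by the
   bound is needed. *)
have T1 : 0 < T + 1 by lra.
pose D := @psd_trace_le R m (T + 1).
have DX0 : D X0.
  by split; [case: X0b|apply: le_trans (trace_bound X0b) _; rewrite lerDl].
have D0 : D 0 by split; [exact: psdmx0|rewrite mxtrace0 ltW].
pose F := oapp A C; pose h := oapp b c.
have [||||lam lam_ge0] := @theorem_of_alternative R m D (option K) F h.
- by exists X0.
- exact: compact_psd_trace_le.
- move=> X Y s [X_ge0 XT] [Y_ge0 YT] /andP[s0 s1].
  have -> : X + s *: (Y - X) = (1 - s) *: X + s *: Y.
    by rewrite scalerBr scalerBl scale1r addrA addrAC.
  split; first by apply: psdmxD; apply: psdmxZ => //; rewrite subr_ge0.
  rewrite mxtraceD !mxtraceZ.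
  have : (1 - s) * \tr X <= (1 - s) * (T + 1) by rewrite ler_wpM2l// subr_ge0.
  have : s * \tr Y <= s * (T + 1) by rewrite ler_wpM2l.
  by lra.
- move=> X [X_ge0 XT]; apply: contrapT => /forallNP noj.
  have Xh j : frob (F j) X <= h j by rewrite leNgt; apply/negP/noj.
  have /cC : sdp_point A b X by split=> // k; exact: (Xh (Some k)).
  by rewrite ltNge (Xh None).
move=> lamD.
have {}lamD X : D X -> 0 < lam None * (frob C X - c) +
    \sum_k lam (Some k) * (frob (A k) X - b k).
  by move=> /lamD; rewrite big_option.
(* With a zero multiplier on the objective, the combination would be
   nonpositive at the feasible point X0. *)
have l0 : 0 < lam None.
  rewrite lt_def lam_ge0 andbT; apply/eqP => l0.
  have := lamD X0 DX0; rewrite l0 mul0r add0r ltNge => /negP; apply.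
  by apply: sumr_le0 => k _; rewrite mulr_ge0_le0// subr_le0; case: X0b.
pose a k := lam (Some k) / lam None.
have a_ge0 k : 0 <= a k by rewrite divr_ge0.
pose M := C + \sum_k a k *: A k.
pose r := c + \sum_k a k * b k.
have rM X : D X -> r <= frob M X.
  move=> /lamD; rewrite -(pmulr_rgt0 _ (_ : 0 < (lam None)^-1)) ?invr_gt0//.
  rewrite mulrDr mulKf ?gt_eqF// mulr_sumr.
  have -> : \sum_k (lam None)^-1 * (lam (Some k) * (frob (A k) X - b k)) =
      \sum_k a k * frob (A k) X - \sum_k a k * b k.
    by rewrite -sumrB; apply: eq_bigr => k _; rewrite /a; ring.
  by rewrite frob_lagrangian /r; lra.
have Msym : M^T = M.
  rewrite linearD linear_sum/= Csym; congr (_ + _); apply: eq_bigr => k _.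
  by rewrite linearZ/= Asym.
have r_le0 : r <= 0 by rewrite -(frob0r M); exact: rM.
pose t := - r / (T + 1).
have t_ge0 : 0 <= t by rewrite divr_ge0 ?oppr_ge0// ltW.
exists (fun k => a k + t * beta k).
  split=> [|k]; last by rewrite addr_ge0// mulr_ge0.
  have -> : C + \sum_k (a k + t * beta k) *: A k = M + t *: 1%:M.
    rewrite -sum_beta scaler_sumr -addrA -big_split/=; congr (_ + _).
    by apply: eq_bigr => k _; rewrite scalerDl scalerA.
  exact: psdmx_add_scalar.
have -> : \sum_k - b k * (a k + t * beta k) = - \sum_k a k * b k - t * T.
  rewrite /T mulr_sumr -opprD -big_split -sumrN; apply: eq_bigr => k _ /=.
  by ring.
have : t * (T + 1) = - r by rewrite divfK// gt_eqF.
rewrite mulrDr mulr1 /r; lra.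
Qed.

(** The hypothesis on [beta] replaces a Slater condition: it makes the feasible
    set bounded, so that a feasible point alone ensures a zero gap. *)
Theorem sdp_strong_duality :
  (exists X, sdp_point A b X) -> sdp_value C A b = dsdp_value C A b.
Proof.
move=> [X0 X0b]; apply/eqP; rewrite eq_le; apply/andP; split; last first.
  apply/ereal_supP => _ [alpha alphaD <-]; apply/ereal_infP => _ [X Xb <-].
  by rewrite lee_fin; exact: weak_duality.
have le_val X : sdp_point A b X -> (sdp_value C A b <= (frob C X)%:E)%E.
  by move=> Xb; apply: ereal_inf_lbound; exists X.
have := le_val X0 X0b.
case Ev : (sdp_value C A b) le_val => [v||] le_val // _; last exact: leNye.
apply/lee_subgt0Pr => e e0.
have [|alpha alphaD alphav] := @lagrange_multipliers (v - e) X0 X0b.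
  by move=> X /le_val; rewrite lee_fin; lra.
apply: (@le_trans _ _ (\sum_k - b k * alpha k)%:E); first by rewrite lee_fin.
by apply: ereal_sup_ubound; exists alpha.
Qed.

End Duality.

(** * The OPF problem *)

Theorem proposition1 (R : realType) (n : nat) (N : network R n) :
  opf_feasible N -> opf_sdp_value N = opf_dsdp_value N.
Proof.
move=> [x xb].
(* The upper voltage constraints, each with weight one, sum to the identity. *)
apply: (@sdp_strong_duality _ _ _ _ _ _ (fun k => (k.2 == VmaxC)%:R)).
- by move=> k; exact: ler0n.
- rewrite -(pair_bigA _ (fun i c => (c == VmaxC)%:R *: opf_mx N (i, c)))/=.
  transitivity (\sum_i volt_mx R i : 'M_(n + n)).
    apply: eq_bigr => i _; rewrite (bigD1 VmaxC)//= eqxx scale1r big1 ?addr0//.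
    by move=> c /negPf->; rewrite scale0r.
  (* The delta matrices of the real and the imaginary coordinates. *)
  by rewrite mx1_sum_delta big_split_ord big_split.
- exact: tr_opf_cost_mx.
- exact: tr_opf_mx.
exists (x *m x^T); split=> [k|]; last exact: psdmx_rank1.
by rewrite frob_rank1; exact: xb.
Qed.
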